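(* Let $G$ be a countable, discrete and amenable group. Let $(X,\mathcal{A},\mu)$ be a Lebesgue probability space and let $T=(T_g)_{g\in G}$ be a measure-preserving $G$-anti-action on $X$. For any $A\in\mathcal{A}$ with $\mu(A)>0$, the set $$\{g\in G:\mu(A\cap T_g^{-1}A)>0\}$$ is both right IP$^{\ast}$ and left IP$^{\ast}$.
   Context: A Lebesgue probability space is a probability space measurably isomorphic to a compact metric space equipped with a complete regular Borel probability measure. A measure-preserving $G$-anti-action $T$ is a family of measurable maps $T_g:X\to X$ ($g\in G$) with $T_{gh}x=T_hT_gx$ and $\mu(T_g^{-1}A)=\mu(A)$ for all $g,h\in G$, $A\in\mathcal{A}$ (and the identity of $G$ acting as the identity map). For a sequence $(x_n)_{n\in\mathbb{N}}$ in $G$, let $\mathbf{FP}_L(x_n)=\{x_{n_k}x_{n_{k-1}}\cdots x_{n_1}: k\geq 1,\ n_1<\dots<n_k\}$ (indices in decreasing order) and $\mathbf{FP}_R(x_n)=\{x_{n_1}x_{n_2}\cdots x_{n_k}: k\geq 1,\ n_1<\dots<n_k\}$ (indices in increasing order). A subset of $G$ is a left (resp. right) IP set if it contains $\mathbf{FP}_L(x_n)$ (resp. $\mathbf{FP}_R(x_n)$) for some sequence $(x_n)$ in $G$. A subset of $G$ is left (resp. right) IP$^{\ast}$ if it has nonempty intersection with every left (resp. right) IP set. A countable group is amenable iff it has a right Følner sequence, i.e. a sequence $(\Phi_n)$ of finite nonempty subsets with $\lim_{n}|\Phi_n\cap\Phi_ng|/|\Phi_n|=1$ for all $g\in G$.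 *)

(* Defs.v *)
From HB Require Import structures.
From mathcomp Require Import all_boot all_order all_algebra.
From mathcomp Require Import finmap.
From mathcomp Require Import all_classical all_reals all_analysis.
Import numFieldNormedType.Exports.

Set Implicit Arguments.
Unset Strict Implicit.
Unset Printing Implicit Defensive.

Import Order.TTheory GRing.Theory Num.Theory.

Local Open Scope classical_set_scope.
Local Open Scope ring_scope.

(* The library's measurable spaces are pointed. *)
#[short(type="pmetricType")]
HB.structure Definition PMetric (R : numDomainType) :=
  {Y of Pointed Y & Metric R Y}.

(* [f] and [g] are total functions, but only their restrictions to the conull
   sets [X0] and [Y0] matter: this is isomorphism modulo null sets. *)
Definition measurably_isomorphic (R : realType) (d d' : measure_display)
    (X : measurableType d) (Y : measurableType d')
    (P : probability X R) (Q : probability Y R) : Prop :=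
  exists (X0 : set X) (Y0 : set Y) (f : X -> Y) (g : Y -> X),
    [/\ [/\ measurable X0, measurable Y0, P X0 = 1%E & Q Y0 = 1%E],
        [/\ forall x, X0 x -> Y0 (f x) /\ g (f x) = x &
            forall y, Y0 y -> X0 (g y) /\ f (g y) = y],
        [/\ measurable_fun X0 f & measurable_fun Y0 g] &
        forall B : set Y, measurable B -> P (X0 `&` f @^-1` B) = Q B].

(* Regularity of a measure on a sigma-algebra [S] containing the open sets. *)
Definition regular_measure (R : realType) (Y : topologicalType)
    (S : set (set Y)) (Q : set Y -> \bar R) : Prop :=
  forall B : set Y, S B ->
    Q B = ereal_inf [set Q U | U in [set U | open U /\ B `<=` U]] /\
    Q B = ereal_sup [set Q K | K in [set K | compact K /\ K `<=` B]].

(* As [Q] is complete, its domain [S] contains the Borel sigma-algebra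
   but need not be equal to it. *)
Definition lebesgue_probability_space (R : realType) (d : measure_display)
    (X : measurableType d) (P : probability X R) : Prop :=
  exists (Y : pmetricType R) (S : set (set Y))
         (Q : probability (g_sigma_algebraType S) R),
    [/\ compact [set: Y],
        sigma_algebra setT S /\ @open Y `<=` S,
        measure_is_complete Q,
        regular_measure S Q &
        measurably_isomorphic P Q].

Definition measure_preserving_antiaction (R : realType) (G : groupType)
    (d : measure_display) (X : measurableType d) (mu : probability X R)
    (T : G -> X -> X) : Prop :=
  [/\ forall g, measurable_fun setT (T g),
      forall g h x, T (g * h)%g x = T h (T g x),
      forall x, T 1%g x = x &
      forall g A, measurable A -> mu (T g @^-1` A) = mu A].

Definition FP_L (G : groupType) (x : nat -> G) : set G :=
  [set g | exists s : seq nat,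
    [/\ s != [::], sorted ltn s & g = (\prod_(i <- rev s) x i)%g]].

Definition FP_R (G : groupType) (x : nat -> G) : set G :=
  [set g | exists s : seq nat,
    [/\ s != [::], sorted ltn s & g = (\prod_(i <- s) x i)%g]].

Definition left_IP (G : groupType) (B : set G) : Prop :=
  exists x : nat -> G, FP_L x `<=` B.

Definition right_IP (G : groupType) (B : set G) : Prop :=
  exists x : nat -> G, FP_R x `<=` B.

Definition left_IPstar (G : groupType) (B : set G) : Prop :=
  forall C : set G, left_IP C -> B `&` C !=set0.

Definition right_IPstar (G : groupType) (B : set G) : Prop :=
  forall C : set G, right_IP C -> B `&` C !=set0.

Definition right_Folner (R : realType) (G : groupType)
    (Phi : nat -> {fset G}) : Prop :=
  (forall n, Phi n != fset0) /\
  forall g : G,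
    (#|` (Phi n `&` [fset (h * g)%g | h in Phi n])%fset|%:R / #|` Phi n|%:R : R)
      @[n --> \oo] --> (1 : R).

(* For countable groups. The real field only serves to take the limit of the
   Folner ratios. *)
Definition amenable (R : realType) (G : groupType) : Prop :=
  exists Phi : nat -> {fset G}, right_Folner R Phi.

(* Main.v *)
Require Import Defs.
From HB Require Import structures.
From mathcomp Require Import all_boot all_order all_algebra.
From mathcomp Require Import all_classical all_reals all_analysis.

(** Infinitely many sets of equal positive measure in a probability space cannot
    be pairwise almost disjoint. Applied to the preimages of [A] under
    [T (h n)], this gives [m < n] with [A] meeting its preimage under
    [T ((h m)^-1 * h n)], equivalently under [T ((h n)^-1 * h m)], in positive
    measure. If [h n] is the product of [x 0, ..., x n.-1] in increasing order,
    then [(h m)^-1 * h n] belongs to [FP_R x]; if [h n] is the inverse of their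
    product in decreasing order, then [(h n)^-1 * h m] belongs to [FP_L x]. *)

Set Implicit Arguments.
Unset Strict Implicit.
Unset Printing Implicit Defensive.

Import Order.TTheory GRing.Theory Num.Theory.

Local Open Scope classical_set_scope.
Local Open Scope ring_scope.

(** Induction on [n]: the overlap of the union so far with [B n] is a finite union of null sets,
    hence null by Boole's inequality, so inclusion-exclusion adds exactly [a]. *)
Lemma pairwise_null_measure_bigsetU (R : realType) (d : measure_display)
    (X : measurableType d) (mu : probability X R) (B : nat -> set X) (a : R) :
  (forall n, measurable (B n)) -> (forall n, mu (B n) = a%:E) ->
  (forall m n, (m < n)%N -> mu (B m `&` B n) = 0%E) ->
  forall n, mu (\big[setU/set0]_(i < n) B i) = (n%:R * a)%:E.
Proof.
move=> mB muB null; elim=> [|n IHn]; first by rewrite big_ord0 measure0 mul0r.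
have mU : measurable (\big[setU/set0]_(i < n) B i).
  exact: bigsetU_measurable.
have nullU : mu ((\big[setU/set0]_(i < n) B i) `&` B n) = 0%E.
  rewrite big_distrl/=; apply/eqP; rewrite -measure_le0.
  have := @Boole_inequality _ _ _ mu (fun i => B i `&` B n) n.
  rewrite [X in (_ <= X)%E]big1; first by apply=> i _; exact: measurableI.
  by move=> i _; exact: null.
have finB : (mu (B n) < +oo)%E by rewrite muB ltry.
rewrite big_ord_recr/=.
transitivity (mu (\big[setU/set0]_(i < n) B i) + mu (B n) -
    mu ((\big[setU/set0]_(i < n) B i) `&` B n))%E; first exact: measureUfinr.
by rewrite nullU sube0 IHn muB -EFinD -natr1 mulrDl mul1r.
Qed.

Lemma exists_positive_intersection (R : realType) (d : measure_display)
    (X : measurableType d) (mu : probability X R) (B : nat -> set X)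
    (a : \bar R) :
  (forall n, measurable (B n)) -> (forall n, mu (B n) = a) -> (0 < a)%E ->
  exists m n, (m < n)%N /\ (0 < mu (B m `&` B n))%E.
Proof.
move=> mB muB a_gt0; apply: contrapT => no_pair.
have null m n : (m < n)%N -> mu (B m `&` B n) = 0%E.
  move=> ltmn; apply: contrapT => /eqP; rewrite -measure_gt0 => pos.
  by apply: no_pair; exists m, n.
have a_fin : a \is a fin_num by rewrite -(muB 0%N) fin_num_measure.
rewrite -(fineK a_fin) in muB a_gt0.
rewrite lte_fin in a_gt0.
have bound n : n%:R * fine a <= 1.
  rewrite -lee_fin -(pairwise_null_measure_bigsetU mB muB null n).
  by apply: probability_le1; exact: bigsetU_measurable.
(* Archimedean choice: this index exceeds [(fine a)^-1], so its product with [fine a] exceeds 1. *)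
have := bound (Num.truncn (fine a)^-1).+1.
by rewrite -ler_pdivlMr// mul1r leNgt truncnS_gt.
Qed.

(** The right-hand set pulls back along [T h] to the left-hand one: the anti-action law makes
    [T (h^-1 * k)] after [T h] equal to [T k]. This order of composition is why the quotient is
    [h^-1 * k] and not [k * h^-1]. *)
Lemma antiaction_measure_translate (R : realType) (G : groupType)
    (d : measure_display) (X : measurableType d) (mu : probability X R)
    (T : G -> X -> X) (A : set X) (h k : G) :
  measure_preserving_antiaction mu T -> measurable A ->
  mu (T h @^-1` A `&` T k @^-1` A) = mu (A `&` T (h^-1 * k)%g @^-1` A).
Proof.
move=> [mT TM _ Tpres] mA.
have mTA g : measurable (T g @^-1` A) by rewrite -[_ @^-1` _]setTI; exact: mT.
rewrite -(Tpres h (A `&` _)); last exact: measurableI.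
congr (mu _); rewrite preimage_setI; congr (_ `&` _).
by apply/seteqP; split=> y /=; rewrite -TM mulVKg.
Qed.

Lemma antiaction_recurrence (R : realType) (G : groupType)
    (d : measure_display) (X : measurableType d) (mu : probability X R)
    (T : G -> X -> X) (A : set X) (h : nat -> G) :
  measure_preserving_antiaction mu T -> measurable A -> (0 < mu A)%E ->
  exists m n, [/\ (m < n)%N,
    (0 < mu (A `&` T ((h m)^-1 * h n)%g @^-1` A))%E &
    (0 < mu (A `&` T ((h n)^-1 * h m)%g @^-1` A))%E].
Proof.
move=> HT mA A_gt0; have [mT _ _ Tpres] := HT.
have mTA n : measurable (T (h n) @^-1` A).
  by rewrite -[_ @^-1` _]setTI; exact: mT.
have muTA n : mu (T (h n) @^-1` A) = mu A by exact: Tpres.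
have [m [n [ltmn pos]]] := exists_positive_intersection mTA muTA A_gt0.
(* Intersection is symmetric, so one pair serves both quotients. *)
by exists m, n; split=> //; rewrite -antiaction_measure_translate// setIC.
Qed.

Lemma index_iota_sorted_nonempty (m n : nat) :
  (m < n)%N -> index_iota m n != [::] /\ sorted ltn (index_iota m n).
Proof.
move=> ltmn; split; last exact: iota_ltn_sorted.
by rewrite -size_eq0 size_iota subn_eq0 -ltnNge.
Qed.

Theorem theorem5 (R : realType) (G : groupType)
    (G_countable : countable [set: G]) (G_amenable : amenable R G)
    (d : measure_display) (X : measurableType d) (mu : probability X R)
    (mu_lebesgue : lebesgue_probability_space mu)
    (T : G -> X -> X) (T_antiaction : measure_preserving_antiaction mu T)
    (A : set X) (A_measurable : measurable A) (A_pos : (0 < mu A)%E) :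
  right_IPstar [set g : G | (0 < mu (A `&` T g @^-1` A))%E] /\
  left_IPstar [set g : G | (0 < mu (A `&` T g @^-1` A))%E].
Proof.
split=> C [x xC].
- pose h n := (\prod_(i <- index_iota 0 n) x i)%g.
  have [m [n [ltmn pos _]]] :=
    antiaction_recurrence h T_antiaction A_measurable A_pos.
  have [ne srt] := index_iota_sorted_nonempty ltmn.
  exists ((h m)^-1 * h n)%g; split=> //; apply: xC.
  exists (index_iota m n); split=> //.
  (* The factors before [m] form a prefix of [h n] and cancel on the left. *)
  by rewrite /h (big_cat_nat (leq0n m) (ltnW ltmn))/= mulKg.
- pose p n := (\prod_(i <- rev (index_iota 0 n)) x i)%g.
  have [m [n [ltmn _ pos]]] :=
    antiaction_recurrence (fun n => (p n)^-1)%g T_antiaction A_measurable A_pos.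
  have [ne srt] := index_iota_sorted_nonempty ltmn.
  exists ((p n)^-1^-1 * (p m)^-1)%g; split=> //; apply: xC.
  exists (index_iota m n); split=> //.
  (* Reversal moves the block from [m] to [n.-1] in front of [p m], which then cancels on the
     right. *)
  rewrite invgK /p /index_iota !subn0 -(subnKC (ltnW ltmn)) iotaD add0n addKn.
  by rewrite rev_cat big_cat/= mulgK.
Qed.
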